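(* Let $(\Omega,\mathcal A,\mu,d)$ be a metric measure space equipped with a doubling Borel probability measure $\mu$, with doubling constant $\lambda\ge 1$. Let $\{B_i\}_{i\in\mathbb N}$ be a sequence of balls in $\Omega$ whose radii satisfy $r(B_i)\to0$ as $i\to\infty$, and suppose that $a,b>1$ are constants such that $\mu(aB_i)\le b\,\mu(B_i)$ for all sufficiently large $i$. Let $E_\infty:=\limsup_{i\to\infty}B_i=\bigcap_{t=1}^\infty\bigcup_{i=t}^\infty B_i$ and put $$\kappa:=\frac12\,\frac{1}{\lambda^{k+1}b},\qquad k:=\max\left\{1,\left\lceil\log_2\frac{6}{a-1}\right\rceil\right\}.$$ Then the following statements are equivalent: (A) $\mu(E_\infty)=1$. (B) For any ball $B$ in $\Omega$, $\mu(E_\infty\cap B)=\mu(B)$. (C) For any ball $B$ in $\Omega$ centred in $\operatorname{supp}\mu$ and any $G\in\mathbb N$, there is a finite sub-collection $\mathcal K_{G,B}\subset\{B_i: i\ge G\}$ of disjoint balls contained in $B$ such that $$\mu\Big(\bigcup_{L\in\mathcal K_{G,B}}L\Big)\ge\kappa\,\mu(B).$$ (D) For any ball $B$ in $\Omega$ centred in $\operatorname{supp}\mu$ and any $G\in\mathbb N$, there is a subset $E_{G,B}\subseteq B$ consisting of a finite union of disjoint balls from $\{B_i:i\ge G\}$, such that $\sum_{i=1}^\infty\mu(E_{G_i,B})=\infty$ for any subsequence $(G_i)_{i\in\mathbb N}$ of the natural numbers, and for any pair of natural numbers $G$ and $G'$ $$\mu(E_{G,B}\cap E_{G',B})\le\frac{1}{\mu(B)\,\kappa^2}\,\mu(E_{G,B})\,\mu(E_{G',B}).$$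 (E) For any ball $B$ in $\Omega$ centred in $\operatorname{supp}\mu$ there is a subsequence $\{L_{i,B}\}_{i\in\mathbb N}$ of $\{B_i\}_{i\in\mathbb N}$ of balls contained in $B$ such that $\sum_{i=1}^\infty\mu(L_{i,B})=\infty$ and, for infinitely many $Q\in\mathbb N$, $$\sum_{s,t=1}^Q\mu(L_{s,B}\cap L_{t,B})\le\frac{1}{\mu(B)\,\kappa^2}\left(\sum_{s=1}^Q\mu(L_{s,B})\right)^2 .$$
   Context: $(\Omega,d)$ is a metric space, $\mathcal A$ is a $\sigma$-algebra on $\Omega$ containing all Borel sets, and $\mu$ is a probability measure on $\mathcal A$. $\operatorname{supp}\mu$ denotes the support of $\mu$, i.e. the smallest closed set of full $\mu$-measure. For $x\in\Omega$ and $r>0$, $B(x,r)=\{y\in\Omega: d(x,y)<r\}$ is the ball centred at $x$ of radius $r$; a ball $B=B(x,r)$ always comes with a prescribed centre $x$ and radius $r(B)=r$, and for $a>0$ we write $aB:=B(x,ar)$. The measure $\mu$ is doubling, with doubling constant $\lambda$, if $\lambda\ge1$ and there is $r_0>0$ such that $\mu(B(x,2r))\le\lambda\,\mu(B(x,r))$ for all $x\in\operatorname{supp}\mu$ and $0<r<r_0$. *)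

(* Defs.v *)
From HB Require Import structures.
From mathcomp Require Import all_boot all_order all_algebra.
From mathcomp Require Import all_classical all_reals all_analysis.
Set Implicit Arguments.
Unset Strict Implicit.
Unset Printing Implicit Defensive.
Import Order.TTheory GRing.Theory Num.Theory.
Import numFieldNormedType.Exports.
Local Open Scope classical_set_scope.
Local Open Scope ring_scope.

(* A metric space carrying a sigma-algebra; the two structures are unrelated
   unless [borel_measurable] is assumed. *)
#[short(type="metricMeasurableType")]
HB.structure Definition MetricMeasurable (d : measure_display)
  (R : numDomainType) := {T of Metric R T & Measurable d T}.

Definition borel_measurable (d : measure_display) (R : realType)
    (T : metricMeasurableType d R) : Prop :=
  forall U : set T, open U -> measurable U.

(* A predicate rather than a function of [mu]: without separability, a smallest
   closed set of full measure need not exist. *)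
Definition is_support (d : measure_display) (R : realType)
    (T : metricMeasurableType d R) (mu : probability T R) (S : set T) : Prop :=
  [/\ closed S, mu S = 1%E &
      forall C : set T, closed C -> mu C = 1%E -> S `<=` C].

Definition doubling (d : measure_display) (R : realType)
    (T : metricMeasurableType d R) (mu : probability T R) (S : set T)
    (lambda : R) : Prop :=
  1 <= lambda /\
  exists2 r0 : R, 0 < r0 &
    forall (x : T) (r : R), S x -> 0 < r < r0 ->
      (mu (ball x (2 * r)) <= lambda%:E * mu (ball x r))%E.

Definition kexp (R : realType) (a : R) : int :=
  Num.max 1 (Num.ceil (ln (6 / (a - 1)) / ln 2)).

(* The outer power is [exprz]: [kexp a] is an integer with [1 <= kexp a]. *)
Definition kappa (R : realType) (lambda a b : R) : R :=
  2^-1 * (lambda ^ (kexp a + 1) * b)^-1.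

(* A finite sub-collection is given by its set [K] of indices; distinct indices
   are required to give disjoint sets. *)
Definition finite_disjoint_from (T : Type) (B : nat -> set T) (G : nat)
    (K : set nat) : Prop :=
  [/\ finite_set K, K `<=` [set i | (G <= i)%N] & trivIset K B].

(* Main.v *)
Require Import Defs.
From HB Require Import structures.
From mathcomp Require Import all_boot all_order all_algebra.
From mathcomp Require Import all_classical all_reals all_analysis.
From mathcomp Require Import measurable_realfun lra ring.
Set Implicit Arguments.
Unset Strict Implicit.
Unset Printing Implicit Defensive.
Import Order.TTheory GRing.Theory Num.Theory.
Import numFieldNormedType.Exports.
Local Open Scope classical_set_scope.
Local Open Scope ring_scope.

(** (B) => (C): the balls [B_i] inside [ball x rho] that meet the support cover
    almost all of [E_oo] in [ball x rho], so finitely many of them carry more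
    than half of its mass. The finite Vitali lemma selects disjoint ones whose
    triples cover these, and since each meets the support at some [y], the
    inclusions [3 B_i <= ball y (2^k (a - 1) r_i)] and
    [ball y ((a - 1) r_i) <= a B_i] bound the loss by [lambda^k b].

    (D) => (E): choose the [G]'s so that the index sets of the [E_G] form
    consecutive blocks of integers, and list the indices of all blocks; the
    second-moment sums up to the end of a block are those of the [E_G].

    (E) => (A): fix [t] and let [V] be the union of the [B_i], [i >= t]. A
    Kochen-Stone estimate gives [mu (V & ball x rho) >= kappa^2 mu (ball x rho)]
    for all balls centred in the support. If the closed set [F = ~` V] had
    positive measure, finitely many disjoint balls of radius [e] centred near
    [F] would carry a fixed proportion of [mu F], hence so would [V] inside the
    [2e]-neighbourhood of [F]; but these parts of [V] decrease to the empty set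
    as [e] tends to [0]. The centres are taken from a countable dense subset of
    the support, which (E) provides: one point of the support in each [B_i]. *)

(** * Finite Vitali covering and its consequence for measures *)

Lemma open_ball_metric (R : realFieldType) (T : metricType R) (x : T) (e : R) :
  open (ball x e).
Proof.
rewrite openE => y; rewrite ballEmdist /= => xye; apply/nbhs_ballP.
exists (e - mdist x y) => /=; first by rewrite subr_gt0.
move=> z; rewrite !ballEmdist /= => yz.
by rewrite (le_lt_trans (metric_triangle x y z))// -ltrBrDl.
Qed.

(** Induction on the length of [s]: keep a ball of largest radius, discard the balls that meet it,
    recurse on the others. A discarded ball has radius at most [r j], so its points lie within
    [3 * r j] of [c j]. Since a largest radius is attained, the factor is 3 rather than the 5 of
    infinite families. *)
Lemma vitali_finite (R : realType) (T : pseudoMetricType R) (c : nat -> T)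
    (r : nat -> R) (s : seq nat) : (forall i, 0 < r i) ->
  exists K : seq nat, [/\ {subset K <= s},
    trivIset [set` K] (fun i => ball (c i) (r i)) &
    forall i, i \in s -> exists2 j, j \in K &
      ball (c i) (r i) `<=` ball (c j) (3 * r j)].
Proof.
move=> r0; have [n] := ubnP (size s); elim: n s => // n IH [_|i0 s' sn].
  by exists [::]; split=> // i j; rewrite /= in_nil.
set s := i0 :: s'; pose B i := ball (c i) (r i).
have maxr : forall l i, exists2 j, j \in i :: l &
    forall k, k \in i :: l -> r k <= r j.
  elim=> [|i1 l IHl] i.
    by exists i; rewrite ?mem_head// => k; rewrite inE => /eqP ->.
  have [j js jm] := IHl i1; have [ij|ji] := leP (r i) (r j).
    by exists j => [|k]; rewrite inE ?js ?orbT// => /predU1P[->|/jm].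
  exists i; first by rewrite mem_head.
  by move=> k; rewrite inE => /predU1P[->//|/jm /le_trans]; apply; exact: ltW.
have [j js jmax] : exists2 j, j \in s & forall k, k \in s -> r k <= r j.
  exact: maxr.
pose s1 := [seq i <- s | `[< B i `&` B j = set0 >]].
(* The filter removes [j] itself, because [B j] contains its centre; hence [s1] is shorter than
   [s]. *)
have s1n : (size s1 < n)%N.
  rewrite size_filter; apply: (@leq_trans (size s)) => //.
  rewrite -(count_predC (fun i => `[< B i `&` B j = set0 >])) -addn1 leq_add2l.
  rewrite -has_count; apply/hasP; exists j => //=; apply/negP => /asboolP.
  rewrite setIid => /seteqP[+ _] => /(_ (c j)); apply.
  exact: ballxx.
have [K [Ks Ktriv Kcov]] := IH _ s1n.
have Kj i : i \in K -> B i `&` B j = set0.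
  by move=> /Ks; rewrite mem_filter => /andP[/asboolP].
exists (j :: K); split.
- move=> i; rewrite inE => /predU1P[->//|/Ks].
  by rewrite mem_filter => /andP[].
- move=> i k /=; rewrite !inE => /predU1P[->|iK] /predU1P[->|kK] //.
  + by rewrite setIC -/(B _) Kj// => -[].
  + by rewrite -/(B _) Kj// => -[].
  + exact: Ktriv.
- move=> i si; have [ij|ij] := asboolP (B i `&` B j = set0).
    have /Kcov[k kK ?] : i \in s1 by rewrite mem_filter si andbT; exact/asboolP.
    by exists k; rewrite // inE kK orbT.
  exists j; first by rewrite mem_head.
  have [z [iz jz]] : B i `&` B j !=set0 by exact/set0P/eqP.
  move=> y iy; have := ball_triangle (ball_triangle jz (ball_sym iz)) iy.
  by apply: le_ball; have := jmax _ si; lra.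
Qed.

Lemma probability_setIl d (T : measurableType d) (R : realType)
    (mu : probability T R) (A X : set T) : measurable A -> measurable X ->
  mu A = 1%E -> mu (A `&` X) = mu X.
Proof.
move=> mA mX A1; have -> : mu X = (mu (X `\` A) + mu (X `&` A))%E.
  exact: measureDI.
have -> : mu (X `\` A) = 0%E.
  apply/eqP; rewrite eq_le measure_ge0 andbT -(subee (x := 1%E))// -A1.
  rewrite {1}A1 -probability_setC//; apply: le_measure; rewrite ?inE//.
  - exact: measurableD.
  - exact: measurableC.
by rewrite add0e setIC.
Qed.

Lemma measure_bigsetU_seq_le d (T : measurableType d) (R : realType)
    (mu : {measure set T -> \bar R}) (F : nat -> set T) (s : seq nat) :
  (forall i, measurable (F i)) ->
  (mu (\big[setU/set0]_(i <- s) F i) <= \sum_(i <- s) mu (F i))%E.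
Proof.
move=> mF; elim: s => [|i s IH]; first by rewrite !big_nil measure0.
rewrite !big_cons; apply: le_trans (leeD2l _ IH); apply: measureU2 => //.
exact: bigsetU_measurable.
Qed.

(** Continuity from below; a strict lower bound is what survives at a finite stage. *)
Lemma measure_bigcup_truncation d (T : measurableType d) (R : realType)
    (mu : {measure set T -> \bar R}) (F : nat -> set T) (D : set nat)
    (e : \bar R) : (forall i, measurable (F i)) ->
  (e < mu (\bigcup_(i in D) F i))%E ->
  exists N, (e < mu (\bigcup_(i in D `&` `I_N) F i))%E.
Proof.
move=> mF eD; pose G N := \bigcup_(i in D `&` `I_N) F i.
have mG N : measurable (G N) by exact: bigcup_measurable.
have GE : \bigcup_(i in D) F i = \bigcup_N G N.
  apply/seteqP; split=> [x [i Di Fx]|x [N _ [i [Di _] Fx]]]; last by exists i.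
  by exists i.+1 => //; exists i => //; split=> //=.
apply: contrapT => /forallNP eG; move: eD; apply/negP; rewrite -leNgt GE.
have Gcvg : mu (G N) @[N --> \oo] --> mu (\bigcup_N G N).
  apply: nondecreasing_cvg_mu => //; first exact: bigcup_measurable.
  move=> m n mn; apply/subsetPset => x [i [Di /= im] Fx].
  by exists i => //; split=> //=; exact: leq_trans mn.
by apply: (cvge_to_le Gcvg); apply: nearW => N; rewrite leNgt; apply/negP/eG.
Qed.

(** Truncation leaves finitely many balls, the selected triples cover them, and each triple costs a
    factor [C]. The lemma serves twice: with [C = lambda^k * b] for the balls [B_i], and with
    [C = lambda^2] for balls of one common radius. *)
Lemma vitali_subfamily_measure d (R : realType) (T : metricMeasurableType d R)
    (mu : probability T R) (c : nat -> T) (r : nat -> R) (D : set nat) (C : R)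
    (e : \bar R) : borel_measurable T -> (forall i, 0 < r i) -> 
  (forall i, D i ->
    (mu (ball (c i) (3 * r i)) <= C%:E * mu (ball (c i) (r i)))%E) ->
  (e < mu (\bigcup_(i in D) ball (c i) (r i)))%E ->
  exists K : set nat, [/\ finite_set K, K `<=` D,
    trivIset K (fun i => ball (c i) (r i)) &
    (e <= C%:E * mu (\bigcup_(i in K) ball (c i) (r i)))%E].
Proof.
move=> borel r0 DC; have mball x s : measurable (ball x s : set T).
  by apply: borel; exact: open_ball_metric.
move=> /measure_bigcup_truncation[//|N eN].
have /finite_seqP[s sE] : finite_set (D `&` `I_N) by exact: finite_setIr.
have [K [Ks Ktriv Kcov]] := vitali_finite c s r0.
have KD : [set` K] `<=` D.
  by move=> i /= /Ks si; have : [set` s] i by []; rewrite -sE => -[].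
(* Each selected ball must be counted once in the sum of measures. *)
have KE : [set` K] = [set` undup K].
  by apply/seteqP; split=> i /=; rewrite mem_undup.
exists [set` K]; split=> //.
apply: (le_trans (ltW eN)).
have : \bigcup_(i in D `&` `I_N) ball (c i) (r i) `<=`
    \big[setU/set0]_(i <- undup K) ball (c i) (3 * r i).
  rewrite sE -bigcup_seq -KE => x [i /= /Kcov[j jK ij] ix].
  by exists j => //; exact: ij.
move=> /(le_measure mu) -/(_ _ _)/le_trans; apply.
- by rewrite inE; exact: bigcup_measurable.
- by rewrite inE; exact: bigsetU_measurable.
apply: (le_trans (measure_bigsetU_seq_le _ _ _)) => //.
rewrite measure_fin_bigcup//; last by apply/finite_seqP; exists K.
rewrite KE -fsbig_seq ?undup_uniq// ge0_sume_distrr//.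
rewrite big_seq [leRHS]big_seq; apply: lee_sum => i.
by rewrite mem_undup => /KD; exact: DC.
Qed.

(** * The constants, and balls centred in the support *)

Lemma kexp_nat (R : realType) (a : R) : 1 < a ->
  exists2 k : nat, kexp a = k & 6 <= 2 ^+ k * (a - 1).
Proof.
move=> a1; have a0 : 0 < a - 1 by rewrite subr_gt0.
have k1 : 1 <= kexp a by rewrite /kexp le_max lexx.
have kE : kexp a = `|kexp a|%N by rewrite gez0_abs// (le_trans _ k1).
exists `|kexp a|%N => //.
have l2 : 0 < ln 2 :> R by rewrite ln_gt0// ltr1n.
rewrite -ler_pdivrMr// -ler_ln ?posrE ?divr_gt0 ?exprn_gt0// lnXn//.
rewrite -[leRHS]mulr_natl -ler_pdivrMr//.
apply: (le_trans (ceil_ge _)); rewrite -[leRHS]/(`|kexp a|%:Z%:~R) -kE ler_int /kexp.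
by rewrite le_max lexx orbT.
Qed.

Lemma kappa_gt0 (R : realType) (lambda a b : R) : 1 <= lambda -> 1 < b ->
  0 < kappa lambda a b.
Proof.
move=> l1 b1; rewrite /kappa mulr_gt0 ?invr_gt0// mulr_gt0 ?exprz_gt0//; lra.
Qed.

Lemma support_meets_open d (R : realType) (T : metricMeasurableType d R)
    (mu : probability T R) (S U : set T) : borel_measurable T ->
  is_support mu S -> open U -> (0 < mu U)%E -> S `&` U !=set0.
Proof.
move=> borel [clS S1 _] oU; rewrite -(probability_setIl _ _ S1).
- by move=> SU0; apply/set0P/eqP => SU; move: SU0; rewrite SU measure0 ltxx.
- by rewrite -(setCK S); apply: measurableC; apply: borel; exact: closed_openC.
- exact: borel.
Qed.

(** If the ball were null, its complement would be a closed set of full measure that misses [x],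
    against the minimality of the support. *)
Lemma support_ball_gt0 d (R : realType) (T : metricMeasurableType d R)
    (mu : probability T R) (S : set T) (x : T) (rho : R) :
  borel_measurable T -> is_support mu S -> S x -> 0 < rho ->
  (0 < mu (ball x rho))%E.
Proof.
move=> borel [_ _ Smin] Sx rho0; rewrite lt0e measure_ge0 andbT.
apply/eqP => mu0; have oB := @open_ball_metric R T x rho.
have : S `<=` ~` ball x rho.
  apply: Smin; first exact: open_closedC.
  by rewrite probability_setC ?mu0 ?sube0//; exact: borel.
by move=> /(_ x Sx); apply; exact: ballxx.
Qed.

Lemma doubling_iter d (R : realType) (T : metricMeasurableType d R)
    (mu : probability T R) (S : set T) (lambda r0 : R) (x : T) (n : nat)
    (s : R) : 0 <= lambda ->
  (forall (x : T) (r : R), S x -> 0 < r < r0 ->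
      (mu (ball x (2 * r)) <= lambda%:E * mu (ball x r))%E) ->
  S x -> 0 < s -> 2 ^+ n * s < r0 ->
  (mu (ball x (2 ^+ n * s)) <= (lambda ^+ n)%:E * mu (ball x s))%E.
Proof.
move=> l0 dbl Sx s0; elim: n => [|n IH] sn; first by rewrite !expr0 mul1r mul1e.
have ns0 : 0 < 2 ^+ n * s by rewrite mulr_gt0// exprn_gt0.
have nsr : 2 ^+ n * s < r0 by apply: le_lt_trans sn; rewrite exprS; lra.
rewrite exprS -mulrA; apply: le_trans (dbl _ _ Sx _) _; first by rewrite ns0.
by rewrite exprS EFinM -muleA lee_wpmul2l ?lee_fin//; exact: IH.
Qed.

(** * From (B) to (C) *)

Lemma disjoint_subfamily_in_ball d (R : realType)
    (T : metricMeasurableType d R) (mu : probability T R) (S : set T)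
    (lambda : R) (c : nat -> T) (r : nat -> R) (a b : R) (x : T) (rho : R)
    (G : nat) :
  borel_measurable T -> is_support mu S -> doubling mu S lambda ->
  (forall i, 0 < r i) -> r i @[i --> \oo] --> 0 -> 1 < a -> 1 < b ->
  (\forall i \near \oo,
    (mu (ball (c i) (a * r i)) <= b%:E * mu (ball (c i) (r i)))%E) ->
  S x -> 0 < rho ->
  mu (lim_sup_set (fun i => ball (c i) (r i)) `&` ball x rho) =
    mu (ball x rho) ->
  exists K : set nat,
    [/\ finite_disjoint_from (fun i => ball (c i) (r i)) G K,
      forall i, K i -> ball (c i) (r i) `<=` ball x rho &
      ((kappa lambda a b)%:E * mu (ball x rho) <=
        mu (\bigcup_(i in K) ball (c i) (r i)))%E].
Proof.
move=> borel suppS [l1 [r0 r0gt dbl]] rgt rcvg a1 b1 nearb Sx rho0 Efull.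
have l0 : 0 <= lambda by lra.
have [k kE k6] := kexp_nat a1.
have a0 : 0 < a - 1 by lra.
have ka0 : 0 < 2 ^+ k * (a - 1) by lra.
pose B i := ball (c i) (r i).
have mball (y : T) s : measurable (ball y s : set T).
  by apply: borel; exact: open_ball_metric.
have mB i : measurable (B i) by exact: mball.
have mE : measurable (lim_sup_set B).
  by apply: bigcapT_measurable => n; exact: bigcup_measurable.
have rsmall e : 0 < e -> \forall i \near \oo, r i < e.
  move=> e0; have /cvgr0_norm_lt/(_ _ e0) := rcvg; apply: filterS => i.
  by rewrite gtr0_norm.
(* Past [M] the bound on [a B_i] holds, and [k] doublings from radius [(a - 1) * r i] stay below
   [r0]. *)
have [M _ HM] : \forall i \near \oo,
    (mu (ball (c i) (a * r i)) <= b%:E * mu (B i))%E /\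
    2 ^+ k * (a - 1) * r i < r0.
  apply: filterI => //.
  have /rsmall : 0 < r0 / (2 ^+ k * (a - 1)) by rewrite divr_gt0.
  by apply: filterS => i; rewrite ltr_pdivlMr// mulrC.
(* The centre [c i] may lie outside the support; a point of [S] in [B i] is where doubling gets
   applied. *)
pose D := [set i | [/\ (G <= i)%N, (M <= i)%N, B i `<=` ball x rho &
  S `&` B i !=set0]].
pose C := lambda ^+ k * b.
have C0 : 0 < C by rewrite mulr_gt0 ?exprn_gt0//; lra.
have DC i : D i -> (mu (ball (c i) (3 * r i)) <= C%:E * mu (B i))%E.
  move=> [_ /HM[abi ri] _ [y [Sy iy]]]; have ri0 := rgt i.
  (* As [c i] is within [r i] of [y], the triple lies within [4 * r i] of [y], and
     [4 <= 6 <= 2^k (a - 1)]. *)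
  have y1 : ball (c i) (3 * r i) `<=` ball y (2 ^+ k * ((a - 1) * r i)).
    move=> z iz; apply: le_ball (ball_triangle (ball_sym iy) iz).
    rewrite mulrA; apply: le_trans (_ : 6 * r i <= _); first by lra.
    by rewrite ler_pM2r.
  have y2 : ball y ((a - 1) * r i) `<=` ball (c i) (a * r i).
    by move=> z yz; apply: le_ball (ball_triangle iy yz); lra.
  apply: (@le_trans _ _ (mu (ball y (2 ^+ k * ((a - 1) * r i))))).
    by apply: le_measure; rewrite ?inE.
  apply: (le_trans (doubling_iter l0 dbl Sy _ _)); first exact: mulr_gt0.
    by rewrite mulrA.
  rewrite /C EFinM -muleA lee_wpmul2l ?lee_fin ?exprn_ge0//.
  by apply: le_trans abi; apply: le_measure; rewrite ?inE.
have p0 := support_ball_gt0 borel suppS Sx rho0.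
have pfin : mu (ball x rho) \is a fin_num by exact: fin_num_measure.
(* The 1/2 in [kappa] arises here: it makes the inequality strict, so that finitely many balls
   suffice. *)
have : ((2^-1)%:E * mu (ball x rho) < mu (\bigcup_(i in D) B i))%E.
  apply: (@lt_le_trans _ _ (mu (ball x rho))).
    rewrite -(fineK pfin) -EFinM lte_fin.
    have : 0 < fine (mu (ball x rho)) by rewrite fine_gt0// p0 ltey_eq pfin.
    by lra.
  have [clS S1 _] := suppS.
  have mS : measurable S.
    by rewrite -(setCK S); apply: measurableC; apply: borel; exact: closed_openC.
  rewrite -Efull -(probability_setIl mS _ S1); last exact: measurableI.
  apply: le_measure; rewrite ?inE.
  - by apply: measurableI => //; exact: measurableI.
  - exact: bigcup_measurable.
  move=> z [Sz [Ez]]; rewrite ballEmdist /= => xz.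
  (* A ball containing [z] stays within twice its radius of [z], so radii below half the gap
     [rho - mdist x z] keep it inside [ball x rho]. *)
  have /rsmall[N _ HN] : 0 < (rho - mdist x z) / 2 by lra.
  have [i /= iN zi] := Ez (maxn N (maxn G M)) I.
  move: iN; rewrite !geq_max => /and3P[Ni Gi Mi].
  exists i => //; split=> //; last by exists z.
  move=> y iy; have := ball_triangle (ball_sym zi) iy.
  rewrite !ballEmdist /= => zy.
  have /= := HN _ Ni; have := metric_triangle x z y; lra.
move=> /(vitali_subfamily_measure borel rgt DC)[K [finK KD Ktriv eK]].
exists K; split=> //.
- by split=> // i /KD[].
- by move=> i /KD[].
move: eK; set V := \bigcup_(i in K) _.
have mV : measurable V by exact: bigcup_measurable.
have Vfin : mu V \is a fin_num by exact: fin_num_measure.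
rewrite -(fineK pfin) -(fineK Vfin) -!EFinM !lee_fin.
move: (fine _) (fine _) (fine_ge0 (measure_ge0 mu V)) => p v v0 pv.
(* Here [kappa] is [1 / (2 * lambda * C)], and [1 <= lambda] gives [C <= lambda * C]. *)
rewrite /kappa kE -PoszD -exprnP addn1 exprS -mulrA -/C.
rewrite mulrAC ler_pdivrMr; last by rewrite mulr_gt0//; lra.
apply: (le_trans pv); rewrite mulrC ler_wpM2l//.
by rewrite ler_peMl// ltW.
Qed.

(** * Full measure from relative density *)

Lemma closed_thickening_bigcap (R : realType) (T : metricType R) (F : set T) :
  closed F -> \bigcap_n \bigcup_(z in F) ball z n.+1%:R^-1 = F.
Proof.
move=> clF; apply/seteqP; split=> [x xU|z Fz n _]; last first.
  by exists z => //; apply: ballxx; rewrite invr_gt0.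
apply: clF => W /nbhs_ballP[e /= e0 eW].
have [n ne] : exists n, n.+1%:R^-1 < e.
  have [n _ /(_ n (leqnn n)) ne] := near_infty_natSinv_lt (PosNum e0).
  by exists n.
have [z Fz zx] := xU n I; exists z; split=> //; apply: eW.
by apply: ball_sym; apply: le_ball zx; exact: ltW.
Qed.

(** Plays the role of the Lebesgue density theorem. The sequence [y] makes the cover of the
    complement of [V] by small balls countable, up to a null set, so that finitely many of them can
    be selected. *)
Lemma full_measure_of_relative_density d (R : realType)
    (T : metricMeasurableType d R) (mu : probability T R) (S : set T)
    (lambda theta : R) (y : nat -> T) (V : set T) :
  borel_measurable T -> is_support mu S -> doubling mu S lambda ->
  (forall i, S (y i)) ->
  (forall x e, S x -> 0 < e -> exists i, ball x e (y i)) ->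
  open V -> 0 < theta ->
  (forall x rho, S x -> 0 < rho ->
    (theta%:E * mu (ball x rho) <= mu (V `&` ball x rho))%E) ->
  mu V = 1%E.
Proof.
move=> borel suppS [l1 [r0 r0gt dbl]] Sy ydense oV theta0 Vtheta.
have mball (x : T) s : measurable (ball x s : set T).
  by apply: borel; exact: open_ball_metric.
have mV : measurable V by exact: borel.
pose F := ~` V; have mF : measurable F by exact: measurableC.
have l0 : 0 <= lambda by lra.
have [clS S1 _] := suppS.
have mS : measurable S.
  by rewrite -(setCK S); apply: measurableC; apply: borel; exact: closed_openC.
suff F0 : mu F = 0%E by rewrite -(setCK V) probability_setC// F0 sube0.
apply/eqP; rewrite eq_le measure_ge0 andbT leNgt; apply/negP => F0.
have Ffin : mu F \is a fin_num by exact: fin_num_measure.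
pose U n := \bigcup_(z in F) ball z (n.+1%:R^-1 : R).
have mU n : measurable (U n).
  by apply: borel; apply: bigcup_open => z _; exact: open_ball_metric.
(* As [V] is open, [F] is closed and equals the intersection of its neighbourhoods [U n]. *)
have UF : \bigcap_n (V `&` U n) = set0.
  rewrite -subset0 => x xU; have [Vx _] := xU 0%N I.
  suff : F x by exact.
  rewrite -(@closed_thickening_bigcap R T F); last exact: open_closedC.
  by move=> n _; have [] := xU n I.
(* [theta] is the given density, 1/2 pays for keeping finitely many balls, and [lambda ^+ 2] for
   tripling the radius, bounded by two doublings. *)
pose C := theta * 2^-1 / lambda ^+ 2.
have C0 : 0 < C by rewrite !mulr_gt0 ?invr_gt0 ?exprn_gt0//; lra.
(* [V & U n] keeps a fixed proportion [C] of [mu F] although it shrinks to the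
   empty set. *)
have CU : \forall n \near \oo, (C%:E * mu F <= mu (V `&` U n))%E.
  have r02 : 0 < r0 / 2 by rewrite divr_gt0.
  apply: filterS (near_infty_natSinv_lt (PosNum r02)) => n /= nr0.
  (* Half of the width of [U n]: a ball of radius [e] whose centre is within [e] of [F] then lies in
     [U n]. *)
  pose e : R := n.+1%:R^-1 / 2.
  have e0 : 0 < e by rewrite divr_gt0// invr_gt0.
  have er0 : 2 ^+ 2 * e < r0.
    by rewrite /e; move: (n.+1%:R^-1) nr0 => u; lra.
  pose D := [set i | exists2 z, F z & ball z e (y i)].
  have DC i : D i ->
      (mu (ball (y i) (3 * e)) <= (lambda ^+ 2)%:E * mu (ball (y i) e))%E.
    move=> _; apply: le_trans (doubling_iter l0 dbl (Sy i) e0 er0).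
    by apply: le_measure; rewrite ?inE//; apply: le_ball; lra.
  have : ((2^-1)%:E * mu F < mu (\bigcup_(i in D) ball (y i) e))%E.
    apply: (@lt_le_trans _ _ (mu F)).
      rewrite -(fineK Ffin) -EFinM lte_fin.
      have : 0 < fine (mu F) by rewrite fine_gt0// F0 ltey_eq Ffin.
      by lra.
    rewrite -(probability_setIl mS _ S1)//; apply: le_measure; rewrite ?inE.
    - exact: measurableI.
    - exact: bigcup_measurable.
    move=> z [Sz Fz]; have [i zi] := ydense z e Sz e0.
    by exists i; [exists z | exact: ball_sym].
  move=> /(vitali_subfamily_measure borel (fun=> e0) DC).
  move=> [K [finK KD Ktriv eK]].
  have thK : (theta%:E * mu (\bigcup_(i in K) ball (y i) e) <=
      mu (V `&` \bigcup_(i in K) ball (y i) e))%E.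
    rewrite setI_bigcupr !measure_fin_bigcup//.
    - rewrite !fsbig_finite// ge0_sume_distrr//.
      by apply: lee_sum => i _; exact: Vtheta.
    - exact: trivIset_setIl.
    - by move=> i _; exact: measurableI.
  have KU : \bigcup_(i in K) ball (y i) e `<=` U n.
    move=> x [i /KD[z Fz zi] ix]; exists z => //.
    by have := ball_triangle zi ix; rewrite /e -splitr.
  have mK : measurable (\bigcup_(i in K) ball (y i) e).
    exact: bigcup_measurable.
  apply: (@le_trans _ _ (mu (V `&` \bigcup_(i in K) ball (y i) e))).
    apply: le_trans thK; move: eK.
    have Kfin := fin_num_measure mu _ mK.
    rewrite -(fineK Ffin) -(fineK Kfin) -!EFinM !lee_fin => eK.
    rewrite /C mulrAC ler_pdivrMr ?exprn_gt0//; last lra.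
    by rewrite -!mulrA ler_pM2l// [leRHS]mulrC.
  apply: le_measure; rewrite ?inE; try exact: measurableI.
  exact: setIS.
have : mu (V `&` U n) @[n --> \oo] --> mu (\bigcap_n (V `&` U n)).
  apply: nonincreasing_cvg_mu.
  - by rewrite ltey_eq fin_num_measure//; exact: measurableI.
  - by move=> n; exact: measurableI.
  - by apply: bigcapT_measurable => n; exact: measurableI.
  - move=> m n mn; apply/subsetPset; apply: setIS => x [z Fz zx].
    by exists z => //; apply: le_ball zx; rewrite lef_pV2 ?posrE// ler_nat.
rewrite UF measure0 => /cvge_to_ge/(_ CU); apply/negP; rewrite -ltNge.
by rewrite mule_gt0// lte_fin.
Qed.

(** * A Kochen-Stone estimate *)

Lemma infinite_set_nat_ge (A : set nat) (N : nat) : infinite_set A ->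
  exists2 n, A n & (N <= n)%N.
Proof.
move=> Aoo; apply: contrapT => AN; apply: Aoo.
apply: (@sub_finite_set _ _ `I_N); last exact: finite_II.
by move=> n An /=; rewrite ltnNge; apply/negP => Nn; apply: AN; exists n.
Qed.

Lemma nneseries_pinfty_ge (R : realType) (u : nat -> \bar R) (M : R) :
  (forall i, 0 <= u i)%E -> (\sum_(0 <= i <oo) u i = +oo)%E ->
  exists n, (M%:E < \sum_(i < n) u i)%E.
Proof.
move=> u0 uoo; apply: contrapT => /forallNP uM.
suff : (\sum_(0 <= i <oo) u i <= M%:E)%E by rewrite uoo.
apply: lime_le; first by apply: is_cvg_nneseries.
by apply: nearW => n; rewrite big_mkord leNgt; apply/negP.
Qed.

(** Obtained by integrating [(f - m)^2 >= 0] on [V], where [f] counts the sets [A i] containing a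
    point; the free parameter [m] replaces the Cauchy-Schwarz inequality. The first [t] sets may
    leave [V], and the last term accounts for them. *)
Lemma second_moment_bound d (T : measurableType d) (R : realType)
    (mu : {measure set T -> \bar R}) (A : nat -> set T) (V : set T)
    (m : R) (t Q : nat) :
  (forall i, measurable (A i)) -> measurable V -> 0 <= m -> (t <= Q)%N ->
  (forall i, (t <= i)%N -> A i `<=` V) ->
  ((2 * m)%:E * \sum_(i < Q) mu (A i) <=
    \sum_(i < Q) \sum_(j < Q) mu (A i `&` A j) +
      ((m ^+ 2)%:E * mu V + (2 * m)%:E * \sum_(i < t) mu (A i)))%E.
Proof.
move=> mA mV m0 tQ AV.
pose ind (X : set T) := fun x : T => (\1_X x : R)%:E.
have ind0 X x : (0 <= ind X x)%E by rewrite lee_fin.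
have mind (X : set T) : measurable X -> measurable_fun [set: T] (ind X).
  by move=> mX; apply/measurable_EFinP; exact: measurable_indic.
have indE X : measurable X -> (\int[mu]_x ind X x = mu X)%E.
  by move=> mX; rewrite integral_indic// setIT.
pose f n := fun x : T => (\sum_(i < n) ind (A i) x)%E.
pose g := fun x : T => (\sum_(i < Q) \sum_(j < Q) ind (A i `&` A j) x)%E.
have mf n : measurable_fun [set: T] (f n).
  by apply: emeasurable_sum => i; exact: mind.
have f0 n x : (0 <= f n x)%E by apply: sume_ge0.
have fE n : (\int[mu]_x f n x = \sum_(i < n) mu (A i))%E.
  rewrite ge0_integral_sum// => [|i]; last exact: mind.
  by apply: eq_bigr => i _; exact: indE.
have mAA i j : measurable (A i `&` A j) by exact: measurableI.
have mg : measurable_fun [set: T] g.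
  by apply: emeasurable_sum => i; apply: emeasurable_sum => j; exact: mind.
have g0 x : (0 <= g x)%E by apply: sume_ge0 => i _; apply: sume_ge0.
have gE : (\int[mu]_x g x = \sum_(i < Q) \sum_(j < Q) mu (A i `&` A j))%E.
  rewrite ge0_integral_sum//.
  - apply: eq_bigr => i _; rewrite ge0_integral_sum//.
    + by apply: eq_bigr => j _; exact: indE.
    + by move=> j; exact: mind.
  - by move=> i; apply: emeasurable_sum => j; exact: mind.
  - by move=> i x _; apply: sume_ge0.
have m20 : 0 <= m ^+ 2 by exact: sqr_ge0.
have mm0 : 0 <= 2 * m by rewrite mulr_ge0.
rewrite -!fE -gE -(indE _ mV) -!ge0_integralZl_EFin//; last exact: mind.
have mZ (k : R) (h : T -> \bar R) : measurable_fun [set: T] h ->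
    measurable_fun [set: T] (fun x => k%:E * h x)%E by exact: measurable_funeM.
have Z0 (k : R) (h : T -> \bar R) : 0 <= k -> (forall x, 0 <= h x)%E ->
    forall x, [set: T] x -> (0 <= k%:E * h x)%E.
  by move=> k0 h0 x _; rewrite mule_ge0.
have mfQ := mZ (2 * m) _ (mf Q); have mft := mZ (2 * m) _ (mf t).
have mVm := mZ (m ^+ 2) _ (mind _ mV).
have mVt := emeasurable_funD mVm mft.
have VZ0 := Z0 (m ^+ 2) (ind V) m20 (ind0 V).
have tZ0 := Z0 (2 * m) (f t) mm0 (f0 t).
have Vt0 : forall x, [set: T] x ->
    (0 <= (m ^+ 2)%:E * ind V x + (2 * m)%:E * f t x)%E.
  by move=> x _; rewrite adde_ge0 ?VZ0 ?tZ0.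
rewrite -(ge0_integralD _ _ VZ0 mVm tZ0 mft)//.
rewrite -(ge0_integralD _ _ (fun x _ => g0 x) mg Vt0 mVt)//.
apply: ge0_le_integral => //.
- by move=> x _; rewrite mule_ge0.
- exact: emeasurable_funD.
move=> x _.
(* Pointwise, [2 m f_Q <= f_Q^2 + m^2] on [V], and [f_Q = f_t] off [V]. *)
pose F n : R := \sum_(i < n) \1_(A i) x.
have fF n : f n x = (F n)%:E by rewrite /f sumEFin.
have -> : g x = (F Q ^+ 2)%:E.
  rewrite /g expr2 /F big_distrlr /= -sumEFin; apply: eq_bigr => i _.
  by rewrite sumEFin; congr _%:E; apply: eq_bigr => j _; rewrite indicI.
rewrite !fF /ind -!EFinM -!EFinD lee_fin.
have F0 : 0 <= F t by apply: sumr_ge0.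
have [Vx|Vx] := pselect (V x).
  rewrite indicE mem_set//= mulr1; have : 0 <= (F Q - m) ^+ 2 by exact: sqr_ge0.
  by have := mulr_ge0 mm0 F0; rewrite sqrrB; lra.
have -> : F Q = F t.
  rewrite /F -!(big_mkord predT (fun i => \1_(A i) x)) (big_cat_nat _ tQ)//=.
  rewrite [X in _ + X]big1_seq ?addr0// => i /andP[_].
  rewrite mem_index_iota => /andP[ti _].
  by rewrite indicE memNset// => /(AV _ ti).
have := sqr_ge0 (F t); have := mulr_ge0 m20 (ler0n R (x \in V)).
by rewrite indicE; lra.
Qed.

(** Divergence makes the first [t] terms negligible. If [C * mu V < 1], the second-moment bound
    rearranges to [S Q * (1 - C * v) <= 2 * S t] for infinitely many [Q], which fails once [S Q] is
    large. *)
Lemma kochen_stone_tail d (T : measurableType d) (R : realType)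
    (mu : probability T R) (A : nat -> set T) (V : set T) (C : R) (t : nat) :
  (forall i, measurable (A i)) -> measurable V -> 0 < C ->
  (forall i, (t <= i)%N -> A i `<=` V) ->
  (\sum_(0 <= i <oo) mu (A i) = +oo)%E ->
  infinite_set [set Q : nat |
    (\sum_(i < Q) \sum_(j < Q) mu (A i `&` A j) <=
      C%:E * (\sum_(i < Q) mu (A i)) ^+ 2)%E] ->
  (1 <= C%:E * mu V)%E.
Proof.
move=> mA mV C0 AV Aoo Qoo.
pose S n := \sum_(i < n) fine (mu (A i)).
have SE n : (\sum_(i < n) mu (A i) = (S n)%:E)%E.
  by rewrite -sumEFin; apply: eq_bigr => i _; rewrite fineK// fin_num_measure.
have S0 n : 0 <= S n by apply: sumr_ge0 => i _; exact: fine_ge0.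
have Smono m n : (m <= n)%N -> S m <= S n.
  move=> mn; rewrite /S -!(big_mkord predT (fun i => fine (mu (A i)))).
  by rewrite (big_cat_nat _ mn)//= lerDl sumr_ge0// => i _; exact: fine_ge0.
have Vfin := fin_num_measure mu _ mV.
rewrite -(fineK Vfin) -EFinM lee_fin leNgt; apply/negP => CV.
set v := fine (mu V) in CV.
have [n] := nneseries_pinfty_ge (2 * S t / (1 - C * v))
  (fun i => measure_ge0 mu (A i)) Aoo.
rewrite SE lte_fin ltr_pdivrMr ?subr_gt0// => Sn.
have [Q /= QC] := infinite_set_nat_ge (maxn n t) Qoo.
rewrite geq_max => /andP[nQ tQ].
have CS0 : 0 <= C * S Q by rewrite mulr_ge0// ltW.
(* The choice [m = C * S Q] makes the second-moment bound linear in [S Q]. *)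
have QE : (\sum_(i < Q) \sum_(j < Q) mu (A i `&` A j) <= (C * S Q ^+ 2)%:E)%E.
  by rewrite EFinM EFin_expe -SE.
have : ((2 * (C * S Q))%:E * (S Q)%:E <=
    (C * S Q ^+ 2)%:E + (((C * S Q) ^+ 2)%:E * v%:E +
    (2 * (C * S Q))%:E * (S t)%:E))%E.
  rewrite -!SE fineK//; apply: le_trans (leeD2r _ QE).
  exact: second_moment_bound.
rewrite -!EFinM -!EFinD lee_fin.
have SQ : 2 * S t < S Q * (1 - C * v).
  by apply: (lt_le_trans Sn); rewrite ler_wpM2r ?subr_ge0 ?Smono// ltW.
have SQ0 : 0 < S Q.
  rewrite lt_neqAle S0 andbT; apply/negP => /eqP SQ0; move: SQ.
  by rewrite -SQ0 mul0r; have := S0 t; lra.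
have : 0 < C * S Q * (S Q * (1 - C * v) - 2 * S t).
  by rewrite mulr_gt0 ?subr_gt0// mulr_gt0.
nra.
Qed.

(** * From (D) to (E): listing the blocks *)

Lemma infinite_set_nat (A : set nat) :
  (forall N, exists2 n, A n & (N <= n)%N) -> infinite_set A.
Proof.
move=> AN /finite_seqP[s As]; have [n An] := AN (\max_(i <- s) i).+1.
rewrite ltnNge => /negP; apply; rewrite As /= in An.
exact: (@leq_bigmax_seq _ s xpredT id).
Qed.

(** [l] iterates the passage to the next element of [J]. The clause on lists turns sums over the
    members of [J] below [N] into sums over an initial segment of [l]. *)
Lemma increasing_enumeration (J : pred nat) :
  (forall n, exists2 m, J m & (n <= m)%N) ->
  exists l : nat -> nat, [/\ {homo l : m n / (m < n)%N}, forall n, J (l n) &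
    forall N, [seq i <- iota 0 N | J i] =
      [seq l i | i <- iota 0 (count J (iota 0 N))]].
Proof.
move=> Joo; have Jex n : exists m, J m && (n <= m)%N.
  by have [m Jm nm] := Joo n; exists m; rewrite Jm.
pose nxt n := ex_minn (Jex n).
have nxtP n : [/\ J (nxt n), (n <= nxt n)%N &
    forall m, J m -> (n <= m)%N -> (nxt n <= m)%N].
  rewrite /nxt; case: ex_minnP => m /andP[Jm nm] mmin; split=> // k Jk nk.
  by apply: mmin; rewrite Jk.
pose l n := iter n (fun m => nxt m.+1) (nxt 0%N).
have Jnxt n : J (nxt n) by have [] := nxtP n.
have lS n : (l n < l n.+1)%N by have [] := nxtP (l n).+1.
have lmono : {homo l : m n / (m < n)%N} by exact: homo_ltn ltn_trans lS.
have Jl n : J (l n) by case: n => [|n]; exact: Jnxt.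
exists l; split=> //.
elim=> // N IH; rewrite -addn1 iotaD filter_cat count_cat add0n /=.
case: ifPn => JN; last by rewrite !addn0 cats0.
rewrite !addn0 iotaD map_cat -IH /= add0n; congr (_ ++ [:: _]).
(* The new member [N] must be [l q]: if [l q < N], then [l q] would equal an earlier [l p]; and
   [l q <= N] by minimality of the next element. *)
set q := count J _ in IH *; apply/eqP; rewrite eqn_leq; apply/andP; split.
  rewrite leqNgt; apply/negP => qN.
  have : l q \in [seq i <- iota 0 N | J i].
    by rewrite mem_filter mem_iota add0n qN Jl.
  rewrite IH => /mapP[p]; rewrite mem_iota add0n => /andP[_ /lmono pq] qp.
  by rewrite qp ltnn in pq.
case qE : q => [|p]; first by have [_ _] := nxtP 0%N; apply.
have [_ _] := nxtP (l p).+1; apply => //.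
have : l p \in [seq i <- iota 0 N | J i].
  by rewrite IH map_f// mem_iota qE /=.
by rewrite mem_filter mem_iota => /and3P[].
Qed.

Lemma sum_nat_blocks (V : nmodType) (F : nat -> V) (P : pred nat)
    (g : nat -> nat) (n : nat) : g 0%N = 0%N -> {homo g : m n / (m < n)%N} ->
  \sum_(0 <= i < g n | P i) F i =
    \sum_(m < n) \sum_(g m <= i < g m.+1 | P i) F i.
Proof.
move=> g0 gmono; elim: n => [|n IH]; first by rewrite g0 big_geq// big_ord0.
rewrite big_ord_recr /= -IH (big_cat_nat (n := g n))//.
exact/ltnW/gmono.
Qed.

Lemma measure_setI_bigcup_seq d (T : measurableType d) (R : realType)
    (mu : {measure set T -> \bar R}) (B : nat -> set T) (X : set T)
    (s : seq nat) : uniq s -> trivIset [set` s] B ->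
  (forall i, measurable (B i)) -> measurable X ->
  (mu (X `&` \bigcup_(i in [set` s]) B i) = \sum_(i <- s) mu (X `&` B i))%E.
Proof.
move=> us sB mB mX; have fs : finite_set [set` s] by apply/finite_seqP; exists s.
have tI : trivIset [set` s] (fun i => X `&` B i) by exact: trivIset_setIl.
rewrite setI_bigcupr fsbig_seq//.
by apply: measure_fin_bigcup => // i _; exact: measurableI.
Qed.

Lemma nneseries_pinfty_of_ge (R : realType) (u : nat -> \bar R) (e : R) :
  0 < e -> (forall i, e%:E <= u i)%E -> (\sum_(0 <= i <oo) u i = +oo)%E.
Proof.
move=> e0 eu; have u0 i : (0 <= u i)%E by apply: le_trans (eu i); rewrite lee_fin ltW.
have en n : ((e *+ n)%:E <= \sum_(0 <= i <oo) u i)%E.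
  apply: le_trans (nneseries_lim_ge n _) => //.
  rewrite big_mkord -[leLHS]/((e *+ n)%:E) -{1}(card_ord n) -sumr_const -sumEFin.
  by apply: lee_sum.
have : (0 <= \sum_(0 <= i <oo) u i)%E by exact: nneseries_ge0.
case: (\sum_(0 <= i <oo) u i)%E en => [L|//|/(_ 0%N)//] en L0.
have := en (Num.bound (L / e)).
rewrite lee_fin -mulr_natr leNgt mulrC -ltr_pdivrMr// archi_boundP//.
by rewrite divr_ge0// ltW.
Qed.

Lemma quasi_independent_subsequence d (T : measurableType d) (R : realType)
    (mu : probability T R) (B E : nat -> set T) (K : nat -> set nat) (C : R) :
  (forall i, measurable (B i)) ->
  (forall G, finite_disjoint_from B G (K G)) ->
  (forall G, E G = \bigcup_(i in K G) B i) ->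
  (forall g : nat -> nat, {homo g : m n / (m < n)%N} ->
    (\sum_(0 <= i <oo) mu (E (g i)) = +oo)%E) ->
  (forall G G', (mu (E G `&` E G') <= C%:E * (mu (E G) * mu (E G')))%E) ->
  exists l : nat -> nat, [/\ {homo l : m n / (m < n)%N},
    forall i, exists G, K G (l i),
    (\sum_(0 <= i <oo) mu (B (l i)) = +oo)%E &
    infinite_set [set Q : nat |
      (\sum_(s < Q) \sum_(t < Q) mu (B (l s) `&` B (l t)) <=
        C%:E * (\sum_(s < Q) mu (B (l s))) ^+ 2)%E]].
Proof.
move=> mB KB EK Eoo EC.
have Kbound G : exists M, forall i, K G i -> (i < M)%N.
  have [/finite_seqP[s Ks] _ _] := KB G; exists (\max_(i <- s) i).+1 => i.
  by rewrite Ks ltnS /= => si; exact: (@leq_bigmax_seq _ s xpredT id).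
have [M KM] := choice Kbound.
(* The next start exceeds all indices in [K (g n)], which are at least [g n] by
   [finite_disjoint_from]; so [K (g n)] lies between [g n] and [g n.+1]. *)
pose g n := iter n (fun m => maxn (M m) m.+1) 0%N.
have gS n : (g n < g n.+1)%N by rewrite /= leq_maxr.
have gM n : (M (g n) <= g n.+1)%N by rewrite /= leq_maxl.
have g0 : g 0%N = 0%N by [].
clearbody g.
have gmono : {homo g : m n / (m < n)%N} by exact: homo_ltn ltn_trans gS.
have gle : {homo g : m n / (m <= n)%N}.
  by apply: homo_leq => // n; [exact: leq_trans | exact: ltnW].
have geid n : (n <= g n)%N.
  by elim: n => // n IH; exact: leq_ltn_trans IH (gS n).
have Kge n i : K (g n) i -> (g n <= i)%N by have [_ Kg _] := KB (g n); exact: Kg.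
have Klt n i : K (g n) i -> (i < g n.+1)%N.
  by move=> /KM iM; exact: leq_trans iM (gM n).
pose J i := `[< exists n, K (g n) i >].
have JK n i : (g n <= i < g n.+1)%N -> J i = `[< K (g n) i >].
  move=> /andP[ni ni1]; apply: asbool_equiv_eq; split=> [[m Kmi]|]; last by exists n.
  suff -> : n = m by [].
  apply/eqP; rewrite eqn_leq; apply/andP; split; rewrite leqNgt; apply/negP => mn.
    by have := leq_trans (Klt _ _ Kmi) (gle _ _ mn); rewrite ltnNge ni.
  by have := leq_trans ni1 (leq_trans (gle _ _ mn) (Kge _ _ Kmi)); rewrite ltnn.
(* If no index from [N] on were in [J], every [E (g (i + N))] would be empty and a divergent series
   would vanish. *)
have Joo N : exists2 i, J i & (N <= i)%N.
  apply: contrapT => JN.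
  have : (\sum_(0 <= i <oo) mu (E (g (i + N)%N)) = +oo)%E.
    by apply: (Eoo (fun i => g (i + N)%N)) => m n mn; apply: gmono; rewrite ltn_add2r.
  rewrite eseries0// => n _ _; rewrite EK bigcup0 ?measure0// => i Ki.
  exfalso; apply: JN; exists i; first by apply/asboolP; exists (n + N)%N.
  by rewrite (leq_trans _ (Kge _ _ Ki))// (leq_trans _ (geid _))// leq_addl.
have [l [lmono Jl lE]] := increasing_enumeration Joo.
(* The number of terms of [l] that come from the first [n] blocks. *)
pose Q n := count J (iota 0 (g n)).
have sumQ n (F : nat -> \bar R) : (\sum_(i < Q n) F (l i) =
    \sum_(m < n) \sum_(g m <= i < g m.+1 | J i) F i)%E.
  rewrite -sum_nat_blocks// -[RHS]big_filter /index_iota subn0 lE big_map.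
  by rewrite -[X in iota _ X]subn0 big_mkord.
have sumE n (X : set T) : measurable X ->
    (\sum_(g n <= i < g n.+1 | J i) mu (X `&` B i) = mu (X `&` E (g n)))%E.
  move=> mX; have sE : K (g n) = [set` [seq i <- index_iota (g n) (g n.+1) | J i]].
    apply/seteqP; split=> i /=.
      move=> Ki; have ni : (g n <= i < g n.+1)%N by rewrite Kge ?Klt.
      by rewrite mem_filter mem_index_iota ni andbT (JK _ _ ni); apply/asboolP.
    by rewrite mem_filter mem_index_iota => /andP[+ ni]; rewrite (JK _ _ ni) => /asboolP.
  rewrite EK sE measure_setI_bigcup_seq ?big_filter//.
  - by rewrite filter_uniq// iota_uniq.
  - by rewrite -sE; have [] := KB (g n).
have sumB n : (\sum_(i < Q n) mu (B (l i)) = \sum_(m < n) mu (E (g m)))%E.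
  rewrite (sumQ n (mu \o B)) /=; apply: eq_bigr => m _.
  rewrite -[E _]setTI -sumE//; apply: eq_bigr => i _.
  by rewrite setTI.
have mE n : measurable (E n) by rewrite EK; exact: bigcup_measurable.
exists l; split=> //.
- by move=> i; have /asboolP[n Kn] := Jl i; exists (g n).
- apply/eqP; rewrite -leye_eq -[leLHS](Eoo _ gmono).
  apply: lime_le; first exact: is_cvg_nneseries.
  apply: nearW => n; rewrite big_mkord -sumB -(big_mkord predT (fun i => mu (B (l i)))).
  exact: nneseries_lim_ge.
(* Since [n <= g n], the first [(l N).+1] blocks reach beyond [l N], so their number of terms
   exceeds [N]. *)
- apply: infinite_set_nat => N; exists (Q (l N).+1); last first.
    have : l N \in [seq i <- iota 0 (g (l N).+1) | J i].
      by rewrite mem_filter Jl mem_iota /= add0n; exact: geid.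
    rewrite lE => /mapP[p]; rewrite mem_iota add0n => /andP[_ pQ] lp.
    suff Np : N = p by rewrite {1}Np; exact: ltnW.
    by apply/eqP; rewrite eqn_leq; apply/andP; split; rewrite leqNgt; apply/negP => /lmono;
      rewrite lp ltnn.
  move: (l N).+1 => {N}n /=; rewrite sumB.
  (* The inner index is gathered into blocks first, against [X = B (l s)]; after exchanging the
     sums, the outer one, against [X = E (g k)]. *)
  have -> : (\sum_(s < Q n) \sum_(t < Q n) mu (B (l s) `&` B (l t)) =
      \sum_(m < n) \sum_(k < n) mu (E (g m) `&` E (g k)))%E.
    under eq_bigr => s _.
      rewrite (sumQ n (fun i => mu (B (l s) `&` B i))).
      under eq_bigr => m _ do rewrite sumE//.
      over.
    rewrite exchange_big /= [RHS]exchange_big /=; apply: eq_bigr => k _.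
    rewrite (sumQ n (fun i => mu (B i `&` E (g k)))); apply: eq_bigr => m _.
    by rewrite setIC -sumE//; apply: eq_bigr => i _; rewrite setIC.
  pose a m := fine (mu (E (g m))).
  have aE m : mu (E (g m)) = (a m)%:E by rewrite fineK// fin_num_measure.
  have -> : (C%:E * (\sum_(m < n) mu (E (g m))) ^+ 2 =
      \sum_(m < n) \sum_(k < n) C%:E * (mu (E (g m)) * mu (E (g k))))%E.
    under eq_bigr do rewrite aE.
    rewrite sumEFin -EFin_expe -EFinM expr2 big_distrlr mulr_sumr -sumEFin.
    apply: eq_bigr => m _; rewrite mulr_sumr -sumEFin.
    by apply: eq_bigr => k _; rewrite !aE.
  by apply: lee_sum => m _; apply: lee_sum.
Qed.

(** * The cycle of implications *)

Theorem proposition1 (d : measure_display) (R : realType)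
    (T : metricMeasurableType d R) (mu : probability T R)
    (supp : set T) (lambda : R)
    (c : nat -> T) (r : nat -> R) (a b : R)
    (hborel : borel_measurable T)
    (hsupp : is_support mu supp)
    (hdoubling : doubling mu supp lambda)
    (hr_gt0 : forall i, 0 < r i)
    (hr_cvg0 : r i @[i --> \oo] --> 0)
    (ha : 1 < a) (hb : 1 < b)
    (hab : \forall i \near \oo,
       (mu (ball (c i) (a * r i)) <= b%:E * mu (ball (c i) (r i)))%E) :
  let B i := ball (c i) (r i) in
  let Einf := lim_sup_set B in
  let kap := kappa lambda a b in
  [<->
    (* (A) *)
    mu Einf = 1%E;
    (* (B) *)
    forall (x : T) (rho : R), 0 < rho -> mu (Einf `&` ball x rho) = mu (ball x rho);
    (* (C) *)
    forall (x : T) (rho : R), supp x -> 0 < rho -> forall G : nat,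
      exists K : set nat,
        [/\ finite_disjoint_from B G K,
            forall i, K i -> B i `<=` ball x rho &
            (kap%:E * mu (ball x rho) <= mu (\bigcup_(i in K) B i))%E];
    (* (D) *)
    forall (x : T) (rho : R), supp x -> 0 < rho ->
      exists E : nat -> set T,
        [/\ forall G : nat,
              E G `<=` ball x rho /\
              (exists2 K : set nat, finite_disjoint_from B G K &
                 E G = \bigcup_(i in K) B i),
            forall g : nat -> nat, {homo g : m n / (m < n)%N} ->
              (\sum_(0 <= i <oo) mu (E (g i)) = +oo)%E &
            forall G G' : nat,
              (mu (E G `&` E G') <=
               ((fine (mu (ball x rho)) * kap ^+ 2)^-1)%:E
                 * (mu (E G) * mu (E G')))%E];
    (* (E) *)
    forall (x : T) (rho : R), supp x -> 0 < rho ->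
      exists l : nat -> nat,
        [/\ {homo l : m n / (m < n)%N},
            forall i, B (l i) `<=` ball x rho,
            (\sum_(0 <= i <oo) mu (B (l i)) = +oo)%E &
            infinite_set [set Q : nat |
              (\sum_(s < Q) \sum_(t < Q) mu (B (l s) `&` B (l t)) <=
               ((fine (mu (ball x rho)) * kap ^+ 2)^-1)%:E
                 * (\sum_(s < Q) mu (B (l s))) ^+ 2)%E]]].
Proof.
move=> B Einf kap.
have mball (x : T) s : measurable (ball x s : set T).
  by apply: hborel; exact: open_ball_metric.
have mB i : measurable (B i) by exact: mball.
have mtail n : measurable (\bigcup_(i in [set i | (n <= i)%N]) B i).
  exact: bigcup_measurable.
have mE : measurable Einf by exact: bigcapT_measurable.
have [lambda1 _] := hdoubling.
have kap0 : 0 < kap by exact: kappa_gt0.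
have ballE (x : T) s : mu (ball x s) = (fine (mu (ball x s)))%:E.
  by rewrite fineK// fin_num_measure.
have ball_gt0 x s : supp x -> 0 < s -> 0 < fine (mu (ball x s)).
  by move=> Sx s0; rewrite -lte_fin -ballE; exact: (support_ball_gt0 hborel hsupp).
tfae.
- by move=> E1 x rho rho0; exact: probability_setIl.
- move=> Efull x rho Sx rho0 G.
  by apply: (disjoint_subfamily_in_ball G hborel hsupp hdoubling) => //; exact: Efull.
- move=> hC x rho Sx rho0; have [K KP] := choice (hC x rho Sx rho0).
  exists (fun G => \bigcup_(i in K G) B i).
  have p0 := ball_gt0 x rho Sx rho0.
  set p := fine (mu (ball x rho)) in p0 *.
  have mK G : measurable (\bigcup_(i in K G) B i) by exact: bigcup_measurable.
  have Ksub G : \bigcup_(i in K G) B i `<=` ball x rho.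
    by apply: bigcup_sub => i Ki; have [_ + _] := KP G; exact.
  have Kge G : ((kap * p)%:E <= mu (\bigcup_(i in K G) B i))%E.
    by have [_ _] := KP G; rewrite ballE EFinM.
  split=> [G|g _|G G'].
  + by split=> //; exists (K G) => //; have [] := KP G.
  + by apply: (@nneseries_pinfty_of_ge _ _ (kap * p)) => //; exact: mulr_gt0.
  (* The intersection has measure at most [p], while both factors on the right are at least
     [kap * p]; this produces the constant [1 / (p * kap^2)]. *)
  + apply: (@le_trans _ _ p%:E).
      rewrite /p -ballE; apply: le_measure; rewrite ?inE//; first exact: measurableI.
      by move=> z [/Ksub].
    have -> : (p%:E = (p * kap ^+ 2)^-1%:E * ((kap * p)%:E * (kap * p)%:E))%E.
      by rewrite -!EFinM; congr _%:E; field; rewrite !gt_eqF.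
    apply: lee_wpmul2l.
      by rewrite lee_fin invr_ge0 mulr_ge0 ?sqr_ge0// ltW.
    by apply: lee_pmul => //; rewrite lee_fin mulr_ge0// ltW.
- move=> hD x rho Sx rho0; have [E [hE Eoo EC]] := hD x rho Sx rho0.
  have /choice[K KP] G : exists K, finite_disjoint_from B G K /\
      E G = \bigcup_(i in K) B i.
    by have [_ [K ? ?]] := hE G; exists K.
  have [l [lmono lK lsum lQ]] :=
    quasi_independent_subsequence mB (fun G => (KP G).1) (fun G => (KP G).2) Eoo EC.
  exists l; split=> // i; have [G Kl] := lK i; have [Esub _] := hE G.
  apply: subset_trans Esub; rewrite (KP G).2.
  exact: (@bigcup_sup _ _ (l i)).
- move=> hE.
  have [x0 Sx0] : supp !=set0.
    have [_ S1 _] := hsupp; apply/set0P/eqP => S0.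
    by move: S1; rewrite S0 measure0 => /eqP; rewrite eq_sym onee_eq0.
  (* [x0] is only the default for balls that miss the support. *)
  have /choice[y yP] i : exists z, supp z /\ (supp `&` B i !=set0 -> B i z).
    have [[z [Sz iz]]|] := pselect (supp `&` B i !=set0); first by exists z.
    by exists x0.
  (* A divergent series has a positive term, so some [B (l i)] inside [ball x e] has positive
     measure and meets the support. *)
  have ydense x e : supp x -> 0 < e -> exists i, ball x e (y i).
    move=> Sx e0; have [l [_ lx lsum _]] := hE x e Sx e0.
    have [i li] : exists i, (0 < mu (B (l i)))%E.
      apply: contrapT => /forallNP l0; move: lsum; rewrite eseries0// => i _ _.
      by apply/eqP; rewrite eq_le measure_ge0 andbT leNgt; apply/negP.
    exists (l i); apply: (lx i); apply: (yP (l i)).2.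
    by apply: (support_meets_open hborel hsupp) => //; exact: open_ball_metric.
  have tail1 n : mu (\bigcup_(i in [set i | (n <= i)%N]) B i) = 1%E.
    set V := \bigcup_(i in _) _.
    apply: (@full_measure_of_relative_density _ _ _ _ _ _ (kap ^+ 2) y V
      hborel hsupp hdoubling _ ydense).
    + by move=> i; exact: (yP i).1.
    + by apply: bigcup_open => i _; exact: open_ball_metric.
    + exact: exprn_gt0.
    move=> x rho Sx rho0; have [l [lmono lx lsum lQ]] := hE x rho Sx rho0.
    have p0 := ball_gt0 x rho Sx rho0; rewrite ballE.
    set p := fine (mu (ball x rho)) in p0 lQ *.
    have lid i : (i <= l i)%N.
      by elim: i => // i IH; exact: leq_ltn_trans IH (lmono _ _ (ltnSn i)).
    have C0 : 0 < (p * kap ^+ 2)^-1 by rewrite invr_gt0 mulr_gt0// exprn_gt0.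
    have mVx : measurable (V `&` ball x rho).
      by apply: measurableI => //; exact: mtail.
    (* From rank [n] on, [i <= l i] puts the balls of the subsequence into the tail union. *)
    have lV i : (n <= i)%N -> B (l i) `<=` V `&` ball x rho.
      move=> ni z iz; split; last exact: lx iz.
      by exists (l i) => //=; exact: leq_trans (lid i).
    (* With [C = 1 / (p * kap^2)] the conclusion [1 <= C * mu] of the estimate is the density bound
       for [theta = kap^2]. *)
    have := kochen_stone_tail (fun i => mB (l i)) mVx C0 lV lsum lQ.
    have Vfin := fin_num_measure mu _ mVx.
    rewrite -(fineK Vfin) -!EFinM !lee_fin mulrC ler_pdivlMr.
      by rewrite mul1r mulrC.
    by rewrite mulr_gt0// exprn_gt0.
  (* Continuity from above: [Einf] is the decreasing limit of tail unions, all of measure 1. *)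
  apply/eqP; rewrite eq_le probability_le1//=.
  have := lim_sup_set_cvg mu B mB; rewrite ltey_eq fin_num_measure// => /(_ isT).
  by move/cvge_to_ge; apply; apply: nearW => n /=; have -> := tail1 n.
Qed.
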